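(* Consider courses $X=\{x_1,\dots,x_n\}$ with capacities $c_1,\dots,c_n$, TAs $T=\{t_1,\dots,t_m\}$, utility functions $u_t$, $v_x$ and grade functions $g_t$, forming an instance of MEFE-Matching such that: (i) there is a positive integer $a$ such that every TA $t_i\in T$ has a valuation function $u_i\colon X\to\{0,a\}$; (ii) for every course $x\in X$ and TA $t\in T$, $v_x(t)=g_t(x)$; (iii) for every subset $X'\subseteq X$, $|N(X')|\ge\sum_{x\in X'}c_x$; (iv) for every course $x$, there are no two distinct TAs $t,t'$ with $u_t(x)=u_{t'}(x)=a$ and $g_t(x)=g_{t'}(x)$. Let $c=c_1+\dots+c_n$, for each $i\in[n]$ let $k_i$ be the $c$-th highest grade in course $x_i$ among all TAs in $T$ (i.e. $k_i=g_t(x_i)$ where $t$ is the TA of rank $c$ when all TAs are ranked $1,\dots,m$ by decreasing grade in $x_i$), and let $k=\min\{k_i\mid x_i\in X\}$. Then, for this value of $k$, a MEFE matching always exists.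
   Context: An instance of MEFE-Matching consists of: a finite set of courses $X=\{x_1,\dots,x_n\}$; a finite set of TAs $T=\{t_1,\dots,t_m\}$; for each TA $t_i$ a utility (valuation) function $u_i=u_{t_i}\colon X\to\mathbb{Z}_{\ge 0}$ and a grade function $g_i=g_{t_i}\colon X\to\mathbb{Q}_{\ge 0}$; for each course $x_i$ a capacity $c_i=c_{x_i}$ (a positive integer) and a utility (valuation) function $v_i=v_{x_i}\colon T\to\mathbb{Z}_{\ge 0}$, where for every TA $t$ and course $x_i$ one has $v_i(t)=0$ if $u_t(x_i)=0$ and $v_i(t)>0$ otherwise; and a number $k\in\mathbb{Q}_{\ge 0}$. For a course $x$, $N(x)$ is the set of TAs positively valued by $x$, and $N(X')=\bigcup_{x\in X'}N(x)$ for $X'\subseteq X$. A matching is a function $\mu\colon T\to X\cup\{\emptyset\}$, where $\mu(t)=\emptyset$ means $t$ is unassigned; by convention $u_t(\emptyset)=0$. It is feasible if $|\mu^{-1}(x_i)|=c_i$ for every course $x_i$ and no TA $t$ is assigned to a course $x$ with $u_t(x)=0$. A MEFE (merit-based envy-free egalitarian) matching is a feasible matching $\mu$ such that (1) (satisfaction of courses) for every course $x_i$, $\mathrm{AvgUtil}(x_i)=\frac{1}{c_i}\sum_{t\in\mu^{-1}(x_i)}v_i(t)\ge k$; and (2) (merit-based envy-freeness) there are no two TAs $t_i,t_j$ with $\mu(t_j)\in X$, $g_i(\mu(t_j))\ge g_j(\mu(t_j))$ and $u_i(\mu(t_j))>u_i(\mu(t_i))$. *)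

(* Defs.v *)
From mathcomp Require Import all_boot all_order all_algebra.

Set Implicit Arguments.
Unset Strict Implicit.
Unset Printing Implicit Defensive.

Import Order.TTheory GRing.Theory Num.Theory.
Local Open Scope ring_scope.

Record mefe_instance (X T : finType) := MefeInstance {
  util : T -> X -> nat;
  grade : T -> X -> rat;
  cap : X -> nat;
  val_course : X -> T -> nat;
  threshold : rat;
  grade_ge0 : forall t x, 0 <= grade t x;
  cap_gt0 : forall x, (0 < cap x)%N;
  val_course_eq0 : forall t x, util t x = 0%N -> val_course x t = 0%N;
  val_course_gt0 : forall t x, util t x <> 0%N -> (0 < val_course x t)%N;
  threshold_ge0 : 0 <= threshold
}.

Section Matching.

Variables (X T : finType) (I : mefe_instance X T).

Definition acceptable (x : X) : {set T} := [set t | (0 < val_course I x t)%N].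

Definition acceptable_set (X' : {set X}) : {set T} :=
  \bigcup_(x in X') acceptable x.

Definition total_cap : nat := (\sum_(x : X) cap I x)%N.

(* [None] stands for being unassigned. *)
Definition matching := {ffun T -> option X}.

Definition assigned (mu : matching) (x : X) : {set T} :=
  [set t | mu t == Some x].

Definition util_opt (t : T) (o : option X) : nat := oapp (util I t) 0%N o.

Definition feasible (mu : matching) : Prop :=
  (forall x, #|assigned mu x| = cap I x) /\
  (forall t x, mu t = Some x -> util I t x <> 0%N).

Definition avg_util (mu : matching) (x : X) : rat :=
  (cap I x)%:R^-1 * \sum_(t in assigned mu x) (val_course I x t)%:R.

Definition courses_satisfied (mu : matching) : Prop :=
  forall x, threshold I <= avg_util mu x.

(* The last inequality forces [t <> t']. *)
Definition merit_envy (mu : matching) (t t' : T) : Prop :=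
  exists x, [/\ mu t' = Some x, grade I t' x <= grade I t x
              & (util_opt t (mu t) < util I t x)%N].

Definition merit_envy_free (mu : matching) : Prop :=
  ~ exists t t', merit_envy mu t t'.

Definition mefe_matching (mu : matching) : Prop :=
  [/\ feasible mu, courses_satisfied mu & merit_envy_free mu].

(* Grades are listed with multiplicity and ranks start at 1, hence [r.-1];
   the value is meaningful only for 1 <= r <= #|T|. *)
Definition ranked_grade (x : X) (r : nat) : rat :=
  nth 0 (sort (fun p q : rat => q <= p) [seq grade I t x | t <- enum T]) r.-1.

End Matching.

(* An empty family has no minimum, so this entails that [A] is inhabited. *)
Definition is_minimum (A : finType) (f : A -> rat) (k : rat) : Prop :=
  (forall x, k <= f x) /\ (exists x, k = f x).

(* Main.v *)
Require Import Defs.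
From mathcomp Require Import all_boot all_order all_algebra.
From mathcomp Require Import perm zify.

(**
With utilities in {0, a}, a TA who holds a course in a feasible matching envies
nobody, so only unassigned TAs can envy.  Hall's theorem yields a feasible
matching.  Take one maximising the sum of all grades: if an unassigned TA
envied the holder of a seat, giving her the seat instead would keep the
matching feasible and, as there are no ties, increase the sum.  If some holder
of a seat of x had a grade below k, then the c TAs with the highest grades in x
would be strictly better in x, and one of them would be unassigned, since only
c - 1 seats remain; that TA would envy the holder.
*)

Set Implicit Arguments.
Unset Strict Implicit.
Unset Printing Implicit Defensive.

Import Order.TTheory GRing.Theory Num.Theory.

(** * Hall's marriage theorem *)

Definition hall_condition (S T : finType) (A : {ffun S -> {set T}}) : bool :=
  [forall J : {set S}, #|J| <= #|\bigcup_(s in J) A s|].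

(* Rado's argument: if [A s] contained two elements, then deleting either one
   would violate the condition, and submodularity of [#|\bigcup_(s in J) A s|]
   in [J] makes the two violations incompatible. *)
Lemma hall_minimal_card1 (S T : finType) (A : {ffun S -> {set T}}) (s : S) :
  hall_condition A ->
  (forall B : {ffun S -> {set T}}, hall_condition B ->
     (forall s, B s \subset A s) -> \sum_s #|A s| <= \sum_s #|B s|) ->
  #|A s| = 1.
Proof.
move=> hallA minA.
have As_gt0 : 0 < #|A s|.
  by move/forallP: (hallA) => /(_ [set s]); rewrite cards1 big_set1.
apply/eqP; rewrite eqn_leq As_gt0 andbT leqNgt; apply/negP => /card_gt1P.
case=> t1 [t2 [t1A t2A t12]].
pose D t := [ffun r => if r == s then A s :\ t else A r].
have violated t : t \in A s ->
    exists2 J : {set S}, s \in J & #|\bigcup_(r in J) D t r| < #|J|.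
  move=> tA; have : ~~ hall_condition (D t).
    have subD r : D t r \subset A r.
      by rewrite ffunE; case: eqP => [->|//]; exact: subsetDl.
    apply/negP => /minA /(_ subD); rewrite leqNgt (bigD1 s) //= [ltnRHS](bigD1 s) //=.
    rewrite ffunE eqxx (cardsD1 t (A s)) tA.
    rewrite (@eq_bigr _ _ _ _ _ _ (fun r => #|D t r|) (fun r => #|A r|)).
      by rewrite add1n addSn ltnSn.
    by move=> r /negPf rs; rewrite ffunE rs.
  rewrite negb_forall => /existsP [J]; rewrite -ltnNge => ltJ; exists J => //.
  apply: contraLR ltJ => sJ; rewrite -leqNgt.
  rewrite (@eq_bigr _ _ _ _ _ _ (D t) A); last first.
    by move=> r rJ; rewrite ffunE; case: eqP rJ => // ->; rewrite (negPf sJ).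
  by move/forallP: hallA.
have [J1 sJ1 lt1] := violated _ t1A; have [J2 sJ2 lt2] := violated _ t2A.
set U1 := \bigcup_(r in J1) D t1 r in lt1.
set U2 := \bigcup_(r in J2) D t2 r in lt2.
(* Since [t1 != t2], each element of [A s] survives one of the two deletions. *)
have leU : #|J1 :|: J2| <= #|U1 :|: U2|.
  apply: leq_trans (forallP hallA (J1 :|: J2)) _; apply: subset_leq_card.
  apply/bigcupsP => r rJ; apply/subsetP => y yA; rewrite inE.
  have [rs | /negPf rs] := eqVneq r s.
    have [yt | yt] := eqVneq y t1.
      apply/orP; right; apply/bigcupP; exists s => //.
      by rewrite ffunE eqxx !inE yt t12.
    apply/orP; left; apply/bigcupP; exists s => //.
    by rewrite ffunE eqxx !inE yt -rs.
  move: rJ; rewrite inE => /orP [rJ | rJ]; apply/orP; [left | right];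
    by apply/bigcupP; exists r => //; rewrite ffunE rs.
(* Away from [s] both families agree with [A]; removing [s] costs only 1 in the final count, while
   the two violations gain 2. *)
have leI : #|(J1 :&: J2) :\ s| <= #|U1 :&: U2|.
  apply: leq_trans (forallP hallA _) _; apply: subset_leq_card.
  apply/bigcupsP => r; rewrite !inE => /and3P [/negPf rs r1 r2].
  apply/subsetP => y yA; rewrite inE; apply/andP; split.
    by apply/bigcupP; exists r => //; rewrite ffunE rs.
  by apply/bigcupP; exists r => //; rewrite ffunE rs.
have := cardsUI U1 U2; have := cardsUI J1 J2.
have := cardsD1 s (J1 :&: J2); rewrite inE sJ1 sJ2 /=.
lia.
Qed.

(** A subfamily of least total size satisfying the condition consists of singletons, which define
    [f]; the condition on pairs makes [f] injective. *)
Lemma hall_marriage (S T : finType) (A : S -> {set T}) :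
  (forall J : {set S}, #|J| <= #|\bigcup_(s in J) A s|) ->
  exists2 f : S -> T, injective f & forall s, f s \in A s.
Proof.
move=> hallA; pose subfamily (B : {ffun S -> {set T}}) :=
  hall_condition B && [forall s, B s \subset A s].
have subA : subfamily (finfun A).
  apply/andP; split; apply/forallP; last by move=> s; rewrite ffunE.
  by move=> J; under eq_bigr do rewrite ffunE.
have [B /andP [hallB /forallP BA] minB] :=
  arg_minnP (fun B : {ffun S -> {set T}} => \sum_s #|B s|) subA.
have cardB s : #|B s| = 1.
  apply: (hall_minimal_card1 s hallB) => C hallC CB; apply: minB.
  by rewrite /subfamily hallC; apply/forallP => r; apply: subset_trans (BA r).
have imB s : exists t, B s == [set t] by have /eqP/cards1P [t ->] := cardB s; exists t.
pose f s := xchoose (imB s).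
have fB s : B s = [set f s] by apply/eqP/(xchooseP (imB s)).
exists f => [s1 s2 f12|s]; last by apply: (subsetP (BA s)); rewrite fB set11.
apply/eqP; apply: contraT => s12.
move/forallP: hallB => /(_ [set s1; s2]).
by rewrite cards2 s12 big_setU1 ?inE //= big_set1 !fB f12 setUid cards1.
Qed.

(** * Ranked grades *)

Lemma nth_count_sorted (l : seq rat) (r : nat) :
  0 < r <= size l -> sorted (fun p q : rat => q <= p)%R l ->
  r <= count (fun q => nth 0 l r.-1 <= q)%R l.
Proof.
case: r => // r /= rl sl.
rewrite -{2}(cat_take_drop r.+1 l) count_cat; apply: leq_trans (leq_addr _ _).
have -> : count (fun q => nth 0 l r <= q)%R (take r.+1 l) = size (take r.+1 l).
  apply/eqP; rewrite -all_count; apply/(all_nthP 0%R) => i.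
  rewrite size_takel // => ir; rewrite nth_take //.
  apply: (sorted_leq_nth _ _ _ sl) => //; rewrite ?inE //.
  - by move=> x y z /= yx zy; apply: le_trans yx.
  - exact: leq_trans rl.
by rewrite size_takel.
Qed.

(** * Feasible matchings and exchanges *)

Section Matchings.

Variables (X T : finType) (I : mefe_instance X T).
Implicit Types (mu : matching X T) (x : X) (t : T).

Lemma leq_ranked_grade x (r : nat) : 0 < r <= #|T| ->
  r <= #|[set t | (ranked_grade I x r <= grade I t x)%R]|.
Proof.
move=> rT; pose s := [seq grade I t x | t <- enum T].
have := @nth_count_sorted (sort (fun p q : rat => q <= p)%R s) r.
rewrite size_sort size_map -cardT => /(_ rT) le_count.
rewrite cardsE cardE size_filter -enumT -(count_map (grade I ^~ x)).
rewrite (leq_trans (le_count _)) ?count_sort //.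
by apply: sort_sorted => p q; apply: le_total.
Qed.

Lemma acceptableE t x : (t \in acceptable I x) = (util I t x != 0).
Proof.
rewrite inE; have [u0|/eqP u0] := eqVneq (util I t x) 0.
  by rewrite val_course_eq0.
by rewrite val_course_gt0.
Qed.

(** Boolean form, so that a feasible matching of greatest welfare can be selected. *)
Definition feasibleb mu : bool :=
  [forall x, #|assigned mu x| == cap I x] &&
  [forall t, oapp (fun x => util I t x != 0) true (mu t)].

Lemma feasibleP mu : reflect (feasible I mu) (feasibleb mu).
Proof.
apply: (iffP andP) => [[/forallP capE /forallP acc]|[capE acc]].
  split=> [x|t x mut]; first exact/eqP.
  by apply/eqP; have := acc t; rewrite mut.
split; apply/forallP; first by move=> x; rewrite capE.
by move=> t; case mut: (mu t) => [x|] //=; apply/eqP/acc.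
Qed.

(** Each course is split into as many seats as its capacity, and seats are matched to TAs by Hall's
    theorem. *)
Lemma hall_feasible :
  (forall X' : {set X}, \sum_(x in X') cap I x <= #|acceptable_set I X'|) ->
  exists mu, feasible I mu.
Proof.
move=> hall; pose seat := {x : X & 'I_(cap I x)}.
have card_seats (P : pred X) : #|[set s : seat | P (tag s)]| = \sum_(x | P x) cap I x.
  under [RHS]eq_bigr => x _ do rewrite -[cap I x]card_ord -sum1_card.
  rewrite -sum1dep_card sig_big_dep /=.
  by apply: eq_bigl => s; rewrite andbT.
have [|f f_inj f_acc] := @hall_marriage seat T (fun s => acceptable I (tag s)).
  (* It suffices to bound all the seats of the courses that [J] meets, because seats of one course
     accept the same TAs. *)
  move=> J; pose P := [set tag s | s in J].
  apply: (@leq_trans (\sum_(x in P) cap I x)).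
    rewrite -(card_seats (mem P)); apply/subset_leq_card/subsetP => s sJ.
    by rewrite inE; apply: imset_f.
  apply: leq_trans (hall P) _; apply/subset_leq_card/bigcupsP => _ /imsetP [s sJ ->].
  exact: (bigcup_sup s).
pose mu : matching X T := [ffun t => omap tag [pick s | f s == t]].
have muP t x : (mu t == Some x) = (t \in f @: [set s | tag s == x]).
  rewrite ffunE; case: pickP => [s /eqP <-|no_s] /=.
    by rewrite mem_imset // inE.
  by apply/esym/negbTE/imsetP => -[s _ ts]; have := no_s s; rewrite -ts eqxx.
exists mu; split=> [x|t x /eqP].
  have -> : assigned mu x = f @: [set s | tag s == x].
    by apply/setP => t; rewrite inE muP.
  by rewrite card_imset // (card_seats (pred1 x)) big_pred1_eq.
rewrite muP => /imsetP [s]; rewrite inE => /eqP <- ->.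
by apply/eqP; rewrite -acceptableE f_acc.
Qed.

Lemma card_matched mu : feasible I mu -> #|[set t | mu t]| = total_cap I.
Proof.
move=> [capE _]; rewrite -sum1dep_card big_mkcond /=.
under eq_bigr => t _.
  have -> : (if mu t then 1 else 0) = \sum_x (mu t == Some x).
    case: (mu t) => [y|] /=; last by rewrite big1.
    by rewrite (bigD1 y) //= eqxx big1 // => x /negPf xy; rewrite eqE /= eq_sym xy.
  over.
rewrite exchange_big; apply: eq_bigr => x _ /=.
by rewrite -capE -sum1dep_card [RHS]big_mkcond; apply: eq_bigr => t _; case: eqP.
Qed.

Definition welfare mu : nat :=
  \sum_t oapp (fun x => val_course I x t) 0 (mu t).

(** Precomposing with a transposition keeps the number of TAs in every course. *)
Definition swap mu t t' : matching X T := [ffun s => mu (tperm t t' s)].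

Lemma swap_feasible mu t t' x : feasible I mu ->
  mu t = None -> mu t' = Some x -> util I t x != 0 -> feasible I (swap mu t t').
Proof.
move=> [capE acc] mut mut' utx; split=> [y|s y].
  rewrite -capE -(card_imset (assigned mu y) (@perm_inj _ (tperm t t'))).
  apply: eq_card => s; rewrite inE ffunE.
  by rewrite -{2}[s](tpermK t t') mem_imset ?inE //; apply: perm_inj.
rewrite ffunE; case: tpermP => [->|->|_ _]; last exact: acc.
  by rewrite mut' => -[<-]; apply/eqP.
by rewrite mut.
Qed.

Lemma swap_welfare mu t t' x : mu t = None -> mu t' = Some x ->
  val_course I x t' < val_course I x t -> welfare mu < welfare (swap mu t t').
Proof.
move=> mut mut' lt_v; have tt' : t' != t.
  by apply: contraTneq isT => tt'; rewrite tt' mut in mut'.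
rewrite /welfare (bigD1 t) // (bigD1 t') //= mut mut'.
rewrite [ltnRHS](bigD1 t) //= [in ltnRHS](bigD1 t') //=.
rewrite !ffunE tpermL tpermR mut mut' /= add0n add0n.
rewrite -addSn leq_add //; apply: eq_leq; apply: eq_bigr => s /andP [st st'].
by rewrite ffunE tpermD // eq_sym.
Qed.

End Matchings.

Theorem theorem12 (X T : finType) (I : mefe_instance X T) (a : nat)
  (a_gt0 : (0 < a)%N)
  (util_binary : forall t x, util I t x = 0%N \/ util I t x = a)
  (val_grade : forall x t, ((val_course I x t)%:R)%R = grade I t x)
  (hall : forall X' : {set X},
     (\sum_(x in X') cap I x <= #|acceptable_set I X'|)%N)
  (no_ties : forall x, ~ exists t t' : T,
     [/\ t <> t', util I t x = a, util I t' x = a & grade I t x = grade I t' x])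
  (threshold_min :
     is_minimum (fun x => ranked_grade I x (total_cap I)) (threshold I)) :
  exists mu : matching X T, mefe_matching I mu.
Proof.
have leg x t t' : (grade I t x <= grade I t' x)%R = (val_course I x t <= val_course I x t').
  by rewrite -!val_grade ler_nat.
have util_neq0 t x : util I t x != 0 -> util I t x = a.
  by case: (util_binary t x) => ->; rewrite ?eqxx.
have [mu0 /feasibleP feas0] := hall_feasible hall.
have [mu /feasibleP feas maxmu] := arg_maxnP (@welfare X T I) feas0.
have [capE acc] := feas.
have top t t' x : mu t = None -> mu t' = Some x -> util I t x != 0 ->
    val_course I x t < val_course I x t'.
  move=> mut mut' utx; rewrite ltnNge; apply/negP => le_v.
  have neq_v : val_course I x t' != val_course I x t.
    apply/eqP => eq_v; apply: (no_ties x); exists t', t; split.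
    - by move=> tt'; rewrite tt' mut in mut'.
    - exact/util_neq0/eqP/acc.
    - exact: util_neq0.
    - by rewrite -!val_grade eq_v.
  have lt_v : val_course I x t' < val_course I x t by rewrite ltn_neqAle neq_v.
  have /feasibleP/maxmu := swap_feasible feas mut mut' utx.
  by rewrite /= leqNgt (swap_welfare mut mut' lt_v).
have [k_le _] := threshold_min.
exists mu; split=> // [x|[t [t' [x [mut' le_g lt_u]]]]].
  have cap_nz : ((cap I x)%:R != 0 :> rat)%R.
    by rewrite pnatr_eq0 -lt0n cap_gt0.
  (* Every single seat, not only the average, meets the threshold. *)
  have seat_ok t : t \in assigned mu x -> (threshold I <= (val_course I x t)%:R)%R.
    rewrite inE => /eqP mut; apply: le_trans (k_le x) _; rewrite val_grade.
    set K := ranked_grade _ _ _; rewrite leNgt; apply/negP => lt_g.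
    have c_bounds : 0 < total_cap I <= #|T|.
      apply/andP; split.
        by rewrite /total_cap (bigD1 x) //= ltn_addr // cap_gt0.
      by have := max_card (mem [set t | mu t]); rewrite (card_matched feas).
    have := leq_ranked_grade I x c_bounds; rewrite -/K -(card_matched feas).
    set best := [set s | (K <= _)%R] => le_best.
    (* [best] has at least as many TAs as are matched; were they all matched, the two sets would
       coincide, yet [t] is matched and outside [best]. *)
    have /subsetPn [s s_best s_free] : ~~ (best \subset [set s | mu s]).
      apply/negP => sub_best.
      have /eqP best_eq : best == [set s | mu s] by rewrite eqEcard sub_best.
      have : t \in best by rewrite best_eq inE mut.
      by rewrite inE leNgt lt_g.
    move: s_best s_free; rewrite !inE => s_best s_free.
    have lt_ts : (grade I t x < grade I s x)%R by apply: lt_le_trans s_best.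
    have mus : mu s = None by move: s_free; case: (mu s).
    (* The grade of [s] exceeds a nonnegative one, so [x] values [s] positively. *)
    have usx : util I s x != 0.
      rewrite -acceptableE inE -(ltr_nat rat) val_grade.
      exact: le_lt_trans (grade_ge0 I t x) lt_ts.
    by have := top _ _ _ mus mut usx; rewrite ltnNge -leg (ltW lt_ts).
  rewrite /avg_util mulrC ler_pdivlMr ?ltr0n ?cap_gt0 // mulr_natr -capE.
  by rewrite -sumr_const; apply: ler_sum => t /seat_ok.
have utx : util I t x != 0 by rewrite -lt0n (leq_trans _ lt_u).
case mut: (mu t) => [y|]; last first.
  by have := top _ _ _ mut mut' utx; rewrite ltnNge -leg le_g.
move: lt_u; rewrite mut /= (util_neq0 t x utx) (util_neq0 t y) ?ltnn //.
exact/eqP/acc.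
Qed.
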